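(* Let $n,m,N$ be positive integers, $p_1,\ldots,p_N,q_1,\ldots,q_N,g_1,\ldots,g_m\in\mathbb{R}[\mathbf{x}]$, $\mathbf{x}=(x_1,\ldots,x_n)$, and $\mathbf{K}=\{\mathbf{x}\in\mathbb{R}^n\mid g_j(\mathbf{x})\ge0,\ j\in[m]\}$. Assume $\mathbf{K}$ is compact, $q_i>0$ on $\mathbf{K}$ for all $i\in[N]$, and the quadratic module $\mathcal{Q}(\mathbf{g})$ is Archimedean. Let $\rho=\inf_{\mathbf{x}\in\mathbf{K}}\sum_{i=1}^N p_i(\mathbf{x})/q_i(\mathbf{x})$ and, for integers $k\ge d_{\min}$, \[ \rho_k=\sup\Big\{c\ \Big|\ c\in\mathbb{R},\ h_i\in\mathbb{R}[\mathbf{x}]_{2k-\max\{\deg q_1,\deg q_i\}}\ (i=2,\ldots,N),\ p_1+\Big(\sum_{i=2}^N h_i-c\Big)q_1\in\mathcal{Q}_k(\mathbf{g}),\ p_i-h_iq_i\in\mathcal{Q}_k(\mathbf{g})\ (i=2,\ldots,N)\Big\}. \] Then $\rho_k\le\rho_{k+1}\le\rho$ for all $k\ge d_{\min}$ and $\rho_k\to\rho$ as $k\to\infty$.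
   Context: $\mathbb{R}[\mathbf{x}]_d$ denotes polynomials of degree at most $d$; $\Sigma[\mathbf{x}]$ denotes the set of sums of squares of polynomials. $\mathbf{g}=\{g_1,\ldots,g_m\}$. The quadratic module is $\mathcal{Q}(\mathbf{g})=\{\sigma_0+\sum_{j=1}^m\sigma_jg_j\mid \sigma_j\in\Sigma[\mathbf{x}]\}$, and the $k$-th truncated quadratic module is $\mathcal{Q}_k(\mathbf{g})=\{\sigma_0+\sum_{j=1}^m\sigma_jg_j\mid\sigma_j\in\Sigma[\mathbf{x}],\ \deg\sigma_0\le 2k,\ \deg(\sigma_jg_j)\le 2k\}$. $\mathcal{Q}(\mathbf{g})$ is Archimedean if there is $M>0$ with $M-x_1^2-\cdots-x_n^2\in\mathcal{Q}(\mathbf{g})$. With $d_j=\lceil \deg(g_j)/2\rceil$, $d_{\min}=\max\{\lceil\deg(p_i)/2\rceil,\lceil\deg(q_i)/2\rceil\ (i\in[N]);\ d_j\ (j\in[m])\}$. *)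

(* Defs.v *)
From HB Require Import structures.
From mathcomp Require Import all_boot all_order all_algebra.
From mathcomp Require Import mpoly.
From mathcomp Require Import all_classical all_reals all_analysis.
Set Implicit Arguments. Unset Strict Implicit. Unset Printing Implicit Defensive.
Import Order.TTheory GRing.Theory Num.Theory numFieldNormedType.Exports.
Local Open Scope ring_scope.

Section POP.
Variables (R : realType) (n : nat).

(* total degree; deg 0 := 0 (msize p = 1 + deg p, msize 0 = 0) *)
Definition deg (p : {mpoly R[n]}) : nat := (msize p).-1.

Definition deg_le (p : {mpoly R[n]}) (d : nat) : Prop := (msize p <= d.+1)%N.

Definition evalp (p : {mpoly R[n]}) (x : 'rV[R]_n) : R := p.@[fun i => x ord0 i].

Definition is_sos (s : {mpoly R[n]}) : Prop :=
  exists l : seq {mpoly R[n]}, s = \sum_(q <- l) q ^+ 2.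

Definition qmodule (m : nat) (g : 'I_m -> {mpoly R[n]}) (f : {mpoly R[n]}) : Prop :=
  exists (s0 : {mpoly R[n]}) (s : 'I_m -> {mpoly R[n]}),
    is_sos s0 /\ (forall j, is_sos (s j)) /\ f = s0 + \sum_(j < m) s j * g j.

Definition qmodule_k (m : nat) (g : 'I_m -> {mpoly R[n]}) (k : nat)
    (f : {mpoly R[n]}) : Prop :=
  exists (s0 : {mpoly R[n]}) (s : 'I_m -> {mpoly R[n]}),
    is_sos s0 /\ (forall j, is_sos (s j)) /\
    deg_le s0 (2 * k) /\ (forall j, deg_le (s j * g j) (2 * k)) /\
    f = s0 + \sum_(j < m) s j * g j.

Definition archimedean_qm (m : nat) (g : 'I_m -> {mpoly R[n]}) : Prop :=
  exists M : R, 0 < M /\ qmodule g (M%:MP - \sum_(i < n) 'X_i ^+ 2).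

Definition semialg (m : nat) (g : 'I_m -> {mpoly R[n]}) : set 'rV[R]_n :=
  [set x | forall j, 0 <= evalp (g j) x].

Definition rho_opt (m N : nat) (g : 'I_m -> {mpoly R[n]})
    (p q : 'I_N -> {mpoly R[n]}) : \bar R :=
  ereal_inf [set (\sum_(i < N) evalp (p i) x / evalp (q i) x)%:E
            | x in semialg g].

(* rho_k (index 1 of the paper is ord0 here), in the extended reals *)
Definition rho_k (m N : nat) (g : 'I_m -> {mpoly R[n]})
    (p q : 'I_N.+1 -> {mpoly R[n]}) (k : nat) : \bar R :=
  ereal_sup [set c%:E | c in
    [set c : R | exists h : 'I_N.+1 -> {mpoly R[n]},
       (forall i : 'I_N.+1, i != ord0 ->
          deg_le (h i) (2 * k - maxn (deg (q ord0)) (deg (q i)))) /\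
       qmodule_k g k (p ord0 + (\sum_(i < N.+1 | i != ord0) h i - c%:MP) * q ord0) /\
       (forall i : 'I_N.+1, i != ord0 -> qmodule_k g k (p i - h i * q i))]].

Definition d_min (m N : nat) (g : 'I_m -> {mpoly R[n]})
    (p q : 'I_N -> {mpoly R[n]}) : nat :=
  maxn (\max_(i < N) maxn (uphalf (deg (p i))) (uphalf (deg (q i))))
       (\max_(j < m) uphalf (deg (g j))).

End POP.

(* Main.v *)
Require Import Defs.
From HB Require Import structures.
From mathcomp Require Import all_boot all_order all_algebra.
From mathcomp Require Import mpoly.
From mathcomp Require Import all_classical all_reals all_analysis.
From mathcomp Require Import ring lra.
Import Order.TTheory GRing.Theory Num.Theory numFieldNormedType.Exports.
Local Open Scope ring_scope.
Local Open Scope classical_set_scope.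
Set Implicit Arguments.
Unset Strict Implicit.

(** If c < rho, choose polynomials h_i slightly below p_i/q_i on K for i >= 2,
    uniformly close enough that p_i - h_i q_i and p_1 + (sum h_i - c) q_1 are all
    positive on K.  Putinar's Positivstellensatz puts them in Q(g), hence in
    Q_k(g) for k large, so rho_k >= c.

    Putinar's theorem: let M be an Archimedean quadratic module and f > 0 wherever
    M >= 0.  If -1 were not in M - f Sigma, a maximal proper quadratic module
    containing M - f Sigma would be total, and a |-> sup {r | a - r in it} would be
    evaluation at a point where M >= 0 and f <= 0.  So s f - 1 is in M for some sum
    of squares s, and an elementary identity then gives f in M. *)

(** * Archimedean quadratic modules *)

Section QuadraticModule.
Variables (R : realType) (A : comNzRingType) (iota : {rmorphism R -> A}).
Implicit Types (a b f : A) (M : set A) (r e : R).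

Definition quadratic_module M :=
  [/\ M 1, forall a b, M a -> M b -> M (a + b)
    & forall a b, M b -> M (a ^+ 2 * b)].

Definition archimedean M := forall a, exists r, M (iota r - a).

Lemma qm_sqr M : quadratic_module M -> forall a, M (a ^+ 2).
Proof. by case=> M1 _ MM a; rewrite -[_ ^+ 2]mulr1; exact: MM. Qed.

Lemma qm_zero M : quadratic_module M -> M 0.
Proof. by move=> qM; have := qm_sqr qM 0; rewrite expr0n. Qed.

Lemma qm_sum M (I : Type) (s : seq I) (P : pred I) (F : I -> A) :
  quadratic_module M -> (forall i, P i -> M (F i)) -> M (\sum_(i <- s | P i) F i).
Proof.
move=> qM MF; have [_ MD _] := qM.
by elim/big_ind : _ => //; exact: qm_zero.
Qed.

Lemma qm_scale M : quadratic_module M ->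
  forall r a, 0 <= r -> M a -> M (iota r * a).
Proof.
move=> [_ _ MM] r a r0 Ma.
by rewrite -(sqr_sqrtr r0) rmorphXn; exact: MM.
Qed.

Lemma qm_unscale M : quadratic_module M ->
  forall r a, 0 < r -> M (iota r * a) -> M a.
Proof.
move=> qM r a r0 Ma.
have -> : a = iota r^-1 * (iota r * a).
  by rewrite mulrA -rmorphM mulVf ?gt_eqF// rmorph1 mul1r.
by apply: qm_scale => //; rewrite invr_ge0 ltW.
Qed.

Lemma qm_const M : quadratic_module M -> forall r, 0 <= r -> M (iota r).
Proof.
by move=> qM r r0; rewrite -[iota r]mulr1; apply: qm_scale => //; case: qM.
Qed.

(** A quadratic module need not be closed under products, so [r - a] and [r + a] are multiplied by
    squares only; the resulting sum is [2r (r^2 - a^2)], and [2r] is a positive constant. *)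
Lemma qm_sqr_le M : quadratic_module M -> forall r a, 0 < r ->
  M (iota r - a) -> M (iota r + a) -> M (iota r ^+ 2 - a ^+ 2).
Proof.
move=> qM r a r0 ra rNa; have [_ MD MM] := qM.
apply: (qm_unscale (r := 2 * r) qM); first by rewrite mulr_gt0.
have -> : iota (2 * r) * (iota r ^+ 2 - a ^+ 2) =
  (iota r + a) ^+ 2 * (iota r - a) + (iota r - a) ^+ 2 * (iota r + a) by ring.
by apply: (MD); exact: MM.
Qed.

Definition sos : set A := [set s | exists l : seq A, s = \sum_(q <- l) q ^+ 2].

Lemma sos_qm : quadratic_module sos.
Proof.
split=> [|_ _ [l ->] [l' ->]|a _ [l ->]].
- by exists [:: 1]; rewrite big_seq1 expr1n.
- by exists (l ++ l'); rewrite big_cat.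
- exists [seq a * q | q <- l]; rewrite big_map mulr_sumr.
  by apply: eq_bigr => q _; rewrite exprMn.
Qed.

Lemma qm_sos_mul M : quadratic_module M ->
  forall s a, sos s -> M a -> M (s * a).
Proof.
move=> qM _ a [l ->] Ma; rewrite mulr_suml; apply: qm_sum => // q _.
by case: qM => _ _; apply.
Qed.

Lemma qm_sos M : quadratic_module M -> sos `<=` M.
Proof.
by move=> qM s ss; rewrite -[s]mulr1; apply: qm_sos_mul => //; case: qM.
Qed.

(** * Adjoining an element, and maximal proper quadratic modules *)

Definition qm_adjoin M b : set A :=
  [set a | exists m s, [/\ M m, sos s & a = m + s * b]].

Lemma qm_adjoin_qm M b : quadratic_module M -> quadratic_module (qm_adjoin M b).
Proof.
move=> [M1 MD MM]; have [_ sD sM] := sos_qm; have s0 := qm_zero sos_qm.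
split=> [|_ _ [m [s [Mm ss ->]]] [m' [s' [Mm' ss' ->]]]|a _ [m [s [Mm ss ->]]]].
- by exists 1, 0; split=> //; rewrite mul0r addr0.
- by exists (m + m'), (s + s'); split; [exact: MD|exact: sD|ring].
- by exists (a ^+ 2 * m), (a ^+ 2 * s); split; [exact: MM|exact: sM|ring].
Qed.

Lemma qm_adjoin_sub M b : M `<=` qm_adjoin M b.
Proof.
move=> a Ma; exists a, 0; split=> //; first exact: qm_zero sos_qm.
by rewrite mul0r addr0.
Qed.

Lemma qm_adjoin_mem M b : quadratic_module M -> qm_adjoin M b b.
Proof.
move=> qM; exists 0, 1; split; first exact: qm_zero.
  by case: sos_qm.
by rewrite mul1r add0r.
Qed.

(** Writing [4b] as [(b + 1)^2 - (b - 1)^2] reduces multiplication by an arbitrary [b] to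
    multiplication by squares. So the support, the intersection of [M] and [-M], is an ideal. *)
Lemma qm_support_ideal M : quadratic_module M ->
  forall a b, M a -> M (- a) -> M (a * b).
Proof.
move=> qM a b Ma MNa; have [_ MD MM] := qM.
apply: (qm_unscale (r := 4) qM) => //.
have -> : iota 4 * (a * b) = (b + 1) ^+ 2 * a + (b - 1) ^+ 2 * - a by ring.
by apply: (MD); exact: MM.
Qed.

(** If neither [a] nor [-a] is in [M], then [-1 = m1 + t1 a = m2 - t2 a]. Eliminating [a] gives
    [-t1 = t2 + t2 m1 + t1 m2], so [t1] is in the support. Then [t1 a] is in [M], and so is [-1]. *)
Lemma qm_total_of_maximal M : quadratic_module M -> ~ M (-1) ->
  (forall b, ~ M b -> qm_adjoin M b (-1)) -> forall a, M a \/ M (- a).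
Proof.
move=> qM MN1 Mmax a; have [_ MD MM] := qM.
apply: contrapT => /not_orP[Ma MNa].
have [m1 [t1 [Mm1 st1 E1]]] := Mmax _ Ma.
have [m2 [t2 [Mm2 st2 E2]]] := Mmax _ MNa.
have Mt1 : M t1 by exact: (qm_sos qM).
have MNt1 : M (- t1).
  have -> : - t1 = t2 + (t2 * m1 + t1 * m2).
    have e1 : m1 = -1 - t1 * a by rewrite E1; ring.
    have e2 : m2 = -1 + t2 * a by rewrite E2; ring.
    by rewrite e1 e2; ring.
  apply: (MD); first exact: qm_sos.
  by apply: (MD); exact: qm_sos_mul.
apply: MN1; rewrite E1; apply: (MD) => //.
exact: qm_support_ideal.
Qed.

(** Zorn's lemma: each closure condition involves at most two elements, which lie in a common member
    of a chain, so it passes to unions. Adjoining any outside element to a maximal module yields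
    [-1], whence totality. *)
Lemma qm_maximal M : quadratic_module M -> ~ M (-1) ->
  exists M', [/\ quadratic_module M', M `<=` M', ~ M' (-1)
    & forall a, M' a \/ M' (- a)].
Proof.
move=> qM MN1.
pose proper S := [/\ quadratic_module S, M `<=` S & ~ S (-1)].
(* the empty chain has an empty union, hence the alternative S = set0 *)
have [F FP Ftot|M' [M'P M'max]] := @Zorn_bigcup A [set S | S = set0 \/ proper S].
  have propF X a : F X -> X a -> proper X.
    by move=> /FP[->|].
  have [->|/set0P[x [X FX Xx]]] := eqVneq (\bigcup_(X in F) X) set0; first by left.
  right; have [[X1 _ _] MX _] := propF _ _ FX Xx.
  split; last 2 first.
  - by move=> a Ma; exists X => //; exact: MX.
  - by move=> [Y FY YN1]; case: (propF _ _ FY YN1).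
  split=> [|a b [Y FY Ya] [Z FZ Zb]|a b [Y FY Yb]]; first by exists X.
  - have [YZ|ZY] := Ftot _ _ FY FZ.
      exists Z => //; have [[_ ZD _] _ _] := propF _ _ FZ Zb.
      by apply: ZD => //; exact: YZ.
    exists Y => //; have [[_ YD _] _ _] := propF _ _ FY Ya.
    by apply: YD => //; exact: ZY.
  - by exists Y => //; have [[_ _ YM] _ _] := propF _ _ FY Yb; exact: YM.
have [qM' MM' M'N1] : proper M'.
  case: M'P => // M'0; exfalso.
  apply: (M'max M); last by right; split.
  rewrite M'0; split=> // /(_ 1).
  by case: qM => /[swap] _ /[swap] _ M1 /(_ M1).
exists M'; split=> //; apply: qm_total_of_maximal => // b M'b.
apply: contrapT => N1; apply: (M'max (qm_adjoin M' b)).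
  split; first exact: qm_adjoin_sub.
  by move=> /(_ b (qm_adjoin_mem b qM')).
right; split=> //; first exact: qm_adjoin_qm.
by move=> a Ma; apply: qm_adjoin_sub; exact: MM'.
Qed.

Lemma qm_neg_const M : quadratic_module M -> forall r, r < 0 -> M (iota r) -> M (-1).
Proof.
move=> qM r r0 Mr; apply: (qm_unscale (r := - r) qM); first by rewrite oppr_gt0.
by rewrite rmorphN mulrN1 opprK.
Qed.

(* The value at [a] of the ring homomorphism to [R] determined by a total
   Archimedean quadratic module, given as a relation. *)
Definition qm_value M a x :=
  forall e, 0 < e -> M (iota (x + e) - a) /\ M (a - iota (x - e)).

(** * The value of a total Archimedean quadratic module is a ring homomorphism to the reals *)

Section Value.
Variable M : set A.
Hypotheses (qM : quadratic_module M) (MN1 : ~ M (-1)).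
Hypotheses (Mtot : forall a, M a \/ M (- a)) (March : archimedean M).

(** The value is the supremum of the [r] with [a - r] in [M]. The Archimedean property bounds this
    set above when applied to [a] and makes it nonempty when applied to [-a]; totality gives the
    upper estimate on [a]. *)
Lemma qm_value_ex a : exists x, qm_value M a x.
Proof.
have [_ MD MM] := qM; have [u Mu] := March a.
have [l Ml] := March (- a).
pose S := [set r | M (a - iota r)].
have Sub r : S r -> r <= u.
  move=> Sr; rewrite leNgt -subr_lt0; apply/negP => /qm_neg_const -/(_ M qM).
  apply: contra_not MN1; apply.
  by have := MD _ _ Mu Sr; congr M; rewrite rmorphB; ring.
have S0 : S !=set0.
  by exists (- l); rewrite /S/= rmorphN; move: Ml; congr M; ring.
have hS : has_sup S by split=> //; exists u => r; exact: Sub.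
exists (sup S) => e e0; split.
  have [|//] := Mtot (a - iota (sup S + e)).
    move=> /(ub_le_sup hS.2); lra.
  by congr M; ring.
have [r Sr ltr] := sup_adherent e0 hS.
have -> : a - iota (sup S - e) = (a - iota r) + iota (r - (sup S - e)).
  by rewrite [iota (r - _)]rmorphB; ring.
by apply: (MD) => //; apply: qm_const; rewrite // subr_ge0 ltW.
Qed.

Lemma qm_value_le a x y : qm_value M a x -> qm_value M a y -> x <= y.
Proof.
move=> ax ay; rewrite leNgt; apply/negP => yx; have [_ MD _] := qM.
(* Adding [a - (x - e)] and [(y + e) - a] puts [y - x + 2e] in [M]; with [e] a third of the gap this
   constant is still negative. *)
have e0 : 0 < (x - y) / 3 by lra.
apply/MN1/(qm_neg_const (r := y - x + 2 * ((x - y) / 3)) qM); first by lra.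
have := MD _ _ (ax _ e0).2 (ay _ e0).1; congr M.
by rewrite !rmorphD !rmorphN !rmorphM rmorph_nat; ring.
Qed.

Lemma qm_value_uniq a x y : qm_value M a x -> qm_value M a y -> x = y.
Proof. by move=> ax ay; apply/le_anti; rewrite !(@qm_value_le a). Qed.

Lemma qm_value_ge0 a x : qm_value M a x -> M a -> 0 <= x.
Proof.
move=> ax Ma; rewrite leNgt; apply/negP => x0; have [_ MD _] := qM.
have e0 : 0 < - x / 2 by lra.
apply/MN1/(qm_neg_const (r := x + - x / 2) qM); first by lra.
by have := MD _ _ (ax _ e0).1 Ma; rewrite subrK.
Qed.

Lemma qm_value_const r : qm_value M (iota r) r.
Proof.
by move=> e e0; rewrite -!rmorphB; split; apply: qm_const => //; lra.
Qed.

Lemma qm_valueD a b x y :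
  qm_value M a x -> qm_value M b y -> qm_value M (a + b) (x + y).
Proof.
move=> ax bY e e0; have [_ MD _] := qM; have e2 : 0 < e / 2 by lra.
have [[a1 a2] [b1 b2]] := (ax _ e2, bY _ e2).
rewrite [e]splitr; split.
  by have := MD _ _ a1 b1; congr M; rewrite !rmorphD; ring.
by have := MD _ _ a2 b2; congr M; rewrite !rmorphD !rmorphN !rmorphD; ring.
Qed.

Lemma qm_valueN a x : qm_value M a x -> qm_value M (- a) (- x).
Proof.
move=> ax e e0; have [a1 a2] := ax _ e0; split.
  by move: a2; congr M; rewrite !rmorphD !rmorphN; ring.
by move: a1; congr M; rewrite !rmorphD !rmorphN; ring.
Qed.

Lemma qm_valueZ c a x : qm_value M a x -> qm_value M (iota c * a) (c * x).
Proof.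
wlog c0 : c / 0 <= c => [IH ax|ax].
  have [/IH/(_ ax)//|c0] := leP 0 c.
  have /IH/(_ ax) /qm_valueN : 0 <= - c by lra.
  by rewrite rmorphN !mulNr !opprK.
move: c0; rewrite le_eqVlt => /predU1P[<-|c0].
  by rewrite rmorph0 !mul0r -(rmorph0 iota); exact: qm_value_const.
move=> e e0; have ec : 0 < e / c by rewrite divr_gt0.
have [a1 a2] := ax _ ec.
have ce : c * (e / c) = e by rewrite mulrCA divff ?mulr1// gt_eqF.
split.
  have := qm_scale qM (ltW c0) a1; congr M.
  by rewrite mulrBr -rmorphM mulrDr ce.
have := qm_scale qM (ltW c0) a2; congr M.
by rewrite mulrBr -rmorphM mulrBr ce.
Qed.

(** Expanding around [x] reduces to value 0. There the lower estimate holds because squares are in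
    [M], and the upper one is [qm_sqr_le] with bound [sqrt e] on [a]. *)
Lemma qm_value_sqr a x : qm_value M a x -> qm_value M (a ^+ 2) (x ^+ 2).
Proof.
wlog x0 : a x / x = 0 => [IH ax|].
  have ax0 : qm_value M (a - iota x) 0.
    by rewrite -(subrr x); apply: qm_valueD => //; apply/qm_valueN/qm_value_const.
  have -> : a ^+ 2 = (a - iota x) ^+ 2 + (iota (2 * x) * (a - iota x) + iota (x ^+ 2)).
    by ring.
  rewrite [X in qm_value _ _ X](_ : _ = 0 ^+ 2 + (2 * x * 0 + x ^+ 2)); last by ring.
  apply: qm_valueD; first exact: IH.
  by apply: qm_valueD; [exact: qm_valueZ|exact: qm_value_const].
rewrite x0 => a0 e e0; rewrite expr0n/= add0r sub0r; have [_ MD _] := qM.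
split; last first.
  rewrite rmorphN opprK; apply: (MD); first exact: qm_sqr.
  exact: (qm_const qM (ltW e0)).
have s0 : 0 < Num.sqrt e by rewrite sqrtr_gt0.
have [a1 a2] := a0 _ s0.
rewrite -(sqr_sqrtr (ltW e0)) rmorphXn; apply: qm_sqr_le => //.
  by move: a1; rewrite add0r.
by move: a2; congr M; rewrite sub0r rmorphN opprK addrC.
Qed.

(** Polarization: the value [c] of [a * b] exists, and computing the value of [(a + b)^2] directly
    and as [(a - b)^2 + 4ab] forces [c = x * y]. *)
Lemma qm_valueM a b x y :
  qm_value M a x -> qm_value M b y -> qm_value M (a * b) (x * y).
Proof.
move=> ax bY; have [c abc] := qm_value_ex (a * b).
suff -> : x * y = c by [].
have D : qm_value M ((a + b) ^+ 2) ((x + y) ^+ 2).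
  by apply: qm_value_sqr; exact: qm_valueD.
have D' : qm_value M ((a + b) ^+ 2) ((x - y) ^+ 2 + 4 * c).
  have -> : (a + b) ^+ 2 = (a - b) ^+ 2 + iota 4 * (a * b) by ring.
  apply: qm_valueD; last exact: qm_valueZ.
  by apply: qm_value_sqr; apply: qm_valueD => //; exact: qm_valueN.
have := qm_value_uniq D D'; lra.
Qed.

End Value.

(* If f + r is in M for some r >= 0, then so is f + r - k^-2, by the identity
   k^2 (f + r) - 1 = (k - s)^2 (f + r) + 2k (s f - 1) + r s (2k - s)
                     + (2k - (s^2 f + 1)). *)
Lemma qm_mem_of_sos_mul M f s : quadratic_module M -> archimedean M ->
  sos s -> M (s * f - 1) -> M f.
Proof.
move=> qM March ss Msf; have [_ MD MM] := qM.
have [k1 Mk1] := March s.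
have [k2 Mk2] := March (s ^+ 2 * f + 1).
(* Chosen positive and so large that [2k] bounds both [s] and [s^2 f + 1], as the identity
   requires. *)
pose k := `|k1| + `|k2| + 1.
have up l a : l <= 2 * k -> M (iota l - a) -> M (iota (2 * k) - a).
  move=> lk Ml.
  have -> : iota (2 * k) - a = (iota l - a) + iota (2 * k - l).
    by rewrite [iota (_ - l)]rmorphB; ring.
  by apply: (MD) => //; apply: qm_const; rewrite // subr_ge0.
have n1 := ler_norm k1; have n2 := ler_norm k2.
have p1 := normr_ge0 k1; have p2 := normr_ge0 k2.
have k0 : 0 < k by rewrite /k; lra.
have {}Mk1 : M (iota (2 * k) - s) by apply: (up k1) => //; rewrite /k; lra.
have {}Mk2 : M (iota (2 * k) - (s ^+ 2 * f + 1)).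
  by apply: (up k2) => //; rewrite /k; lra.
have Ms2 : M (s * (iota (2 * k) - s)).
  apply: (qm_unscale (r := 2 * k) qM); first by lra.
  have -> : iota (2 * k) * (s * (iota (2 * k) - s)) =
    s ^+ 2 * (iota (2 * k) - s) + (iota (2 * k) - s) ^+ 2 * s by ring.
  by apply: (MD); apply: (MM) => //; exact: qm_sos.
have kk : k ^+ 2 * k ^- 2 = 1 by rewrite mulfV// expf_neq0// gt_eqF.
have step r : 0 <= r -> M (f + iota r) -> M (f + iota (r - k ^- 2)).
  move=> r0 Mr; apply: (qm_unscale (r := k ^+ 2) qM); first by rewrite exprn_gt0.
  have -> : iota (k ^+ 2) * (f + iota (r - k ^- 2)) =
      (iota k - s) ^+ 2 * (f + iota r) + iota (2 * k) * (s * f - 1)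
      + iota r * (s * (iota (2 * k) - s)) + (iota (2 * k) - (s ^+ 2 * f + 1)).
    rewrite mulrDr -rmorphM mulrBr kk; ring.
  apply: (MD _ _ _ Mk2); apply: (MD); last exact: qm_scale.
  apply: (MD); first exact: MM.
  by apply: qm_scale => //; lra.
(* Finitely many decrements by the fixed amount [k^-2] bring [r] to at most 0; then [f] is [f + r]
   plus the nonnegative constant [-r]. *)
have iter j : forall r, r <= j%:R * k ^- 2 -> M (f + iota r) -> M f.
  elim: j => [|j IH] r.
    rewrite mul0r => r0 Mr.
    have -> : f = f + iota r + iota (- r) by rewrite rmorphN; ring.
    by apply: (MD) => //; apply: qm_const => //; lra.
  rewrite -natr1 mulrDl mul1r => rj Mr; have [r0|r0] := leP 0 r.
    by apply: (IH (r - k ^- 2)); [lra|exact: step].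
  apply: (IH r) => //; apply: ltW; apply: lt_le_trans r0 _.
  by rewrite mulr_ge0// invr_ge0 exprn_ge0// ltW.
have [r Mr] := March (- f).
have [j rj] : exists j : nat, r <= j%:R * k ^- 2.
  exists (Num.truncn (`|r| * k ^+ 2)).+1.
  rewrite -ler_pdivrMr ?invr_gt0 ?exprn_gt0// invrK.
  apply: le_trans (ltW (truncnS_gt _)).
  by apply: ler_wpM2r (ler_norm _); rewrite exprn_ge0// ltW.
by apply: (iter j r) => //; move: Mr; rewrite opprK addrC.
Qed.

(** * The subring of elements bounded by constants modulo a quadratic module *)

Definition qm_bounded M a := exists r, M (iota r - a) /\ M (iota r + a).

Section Bounded.
Variable M : set A.
Hypothesis qM : quadratic_module M.

Lemma qm_bounded_const r : qm_bounded M (iota r).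
Proof.
exists `|r|; rewrite -rmorphB -rmorphD; split; apply: qm_const => //.
  by rewrite subr_ge0 ler_norm.
by rewrite -[r in _ + r]opprK subr_ge0 -normrN ler_norm.
Qed.

Lemma qm_boundedN a : qm_bounded M a -> qm_bounded M (- a).
Proof. by move=> [r [r1 r2]]; exists r; rewrite opprK. Qed.

Lemma qm_boundedD a b : qm_bounded M a -> qm_bounded M b -> qm_bounded M (a + b).
Proof.
have [_ MD _] := qM; move=> [r [r1 r2]] [t [t1 t2]].
exists (r + t); rewrite rmorphD; split.
  by have := MD _ _ r1 t1; congr M; ring.
by have := MD _ _ r2 t2; congr M; ring.
Qed.

Lemma qm_bounded_unscale a r : 0 < r -> qm_bounded M (iota r * a) -> qm_bounded M a.
Proof.
move=> r0 [t [t1 t2]]; exists (r^-1 * t).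
have rt : iota r * iota (r^-1 * t) = iota t.
  by rewrite -rmorphM mulrA mulfV ?mul1r// gt_eqF.
by split; apply: (qm_unscale (r := r) qM) => //; rewrite ?mulrBr ?mulrDr rt.
Qed.

Lemma qm_bounded_sqr a : qm_bounded M a -> qm_bounded M (a ^+ 2).
Proof.
(* The bound is enlarged to a positive one, as [qm_sqr_le] demands. *)
have [_ MD _] := qM; move=> [r [r1 r2]]; pose t := `|r| + 1.
have t0 : 0 < t by rewrite /t ltr_wpDl.
have rt : iota t = iota r + iota (t - r) by rewrite -rmorphD addrC subrK.
have Mrt : M (iota (t - r)).
  by apply: qm_const => //; have := ler_norm r; rewrite /t; lra.
exists (t ^+ 2); split.
  rewrite rmorphXn; apply: qm_sqr_le => //; rewrite rt.
    by rewrite addrAC; exact: MD.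
  by rewrite addrAC; exact: MD.
by apply: (MD); [apply: qm_const => //; exact: sqr_ge0|exact: qm_sqr].
Qed.

Lemma qm_boundedM a b : qm_bounded M a -> qm_bounded M b -> qm_bounded M (a * b).
Proof.
move=> Ba Bb; apply: (qm_bounded_unscale (r := 4)) => //.
have -> : iota 4 * (a * b) = (a + b) ^+ 2 - (a - b) ^+ 2 by ring.
apply: qm_boundedD; first exact/qm_bounded_sqr/qm_boundedD.
by apply/qm_boundedN/qm_bounded_sqr/qm_boundedD => //; exact: qm_boundedN.
Qed.

(** Adding [(1 - a)^2] or [(1 + a)^2] to [r - a^2] cancels the square and leaves [r + 1 - 2a] or
    [r + 1 + 2a]. *)
Lemma qm_bounded_of_sqr a r : M (iota r - a ^+ 2) -> qm_bounded M a.
Proof.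
have [_ MD _] := qM; move=> Mr; apply: (qm_bounded_unscale (r := 2)) => //.
exists (r + 1); split.
  have := MD _ _ Mr (qm_sqr qM (1 - a)); congr M.
  by rewrite rmorphD rmorph1; ring.
have := MD _ _ Mr (qm_sqr qM (1 + a)); congr M.
by rewrite rmorphD rmorph1; ring.
Qed.

End Bounded.

End QuadraticModule.

(** * Putinar's Positivstellensatz *)

Section Putinar.
Variables (R : realType) (n : nat).
Notation P := {mpoly R[n]}.
Notation iota := (@mpolyC n R : {rmorphism R -> P}).
Implicit Types (M : set P) (f p : P) (x : 'rV[R]_n).

Lemma evalpD f p x : evalp (f + p) x = evalp f x + evalp p x.
Proof. exact: mevalD. Qed.

Lemma evalpN f x : evalp (- f) x = - evalp f x.
Proof. exact: mevalN. Qed.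

Lemma evalpB f p x : evalp (f - p) x = evalp f x - evalp p x.
Proof. exact: mevalB. Qed.

Lemma evalpM f p x : evalp (f * p) x = evalp f x * evalp p x.
Proof. exact: mevalM. Qed.

Lemma evalpC c x : evalp c%:MP x = c.
Proof. exact: mevalC. Qed.

Lemma evalp1 x : evalp 1 x = 1.
Proof. exact: rmorph1. Qed.

Lemma evalpE f k x : evalp (f ^+ k) x = evalp f x ^+ k.
Proof. by rewrite /evalp rmorphXn. Qed.

Lemma evalp_sum (I : Type) (s : seq I) (Q : pred I) (F : I -> P) x :
  evalp (\sum_(i <- s | Q i) F i) x = \sum_(i <- s | Q i) evalp (F i) x.
Proof. exact: (raddf_sum (meval (fun i => x ord0 i))). Qed.

Lemma mpoly_ring_ind (Q : P -> Prop) :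
  (forall c, Q c%:MP) -> (forall i, Q 'X_i) ->
  (forall f p, Q f -> Q p -> Q (f + p)) ->
  (forall f p, Q f -> Q p -> Q (f * p)) -> forall f, Q f.
Proof.
move=> QC QX QD QM; elim/mpolyind => [|c m f _ _ Qf].
  by rewrite -(mpolyC0 n); exact: QC.
apply: QD => //; rewrite -mul_mpolyC; apply: (QM); first exact: QC.
rewrite mpolyXE_id; apply: (big_ind Q) => [|f' p'|i _].
- by rewrite -(mpolyC1 n); exact: QC.
- exact: QM.
- elim: (m i) => [|k IH]; first by rewrite expr0 -(mpolyC1 n); exact: QC.
  by rewrite exprS; exact: QM.
Qed.

(** Bounded elements form a subring containing the constants, so only the variables need a bound;
    [r - X_i^2] is the given member of [M] plus the other squares. *)
Lemma qm_archimedean M : quadratic_module M ->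
  (exists r : R, M (r%:MP - \sum_(i < n) 'X_i ^+ 2)) -> archimedean iota M.
Proof.
move=> qM [r Mr] f; have [_ MD _] := qM.
suff [t [Mt _]] : qm_bounded iota M f by exists t.
elim/mpoly_ring_ind : f => [c|i|f p|f p].
- exact: qm_bounded_const.
- apply: (qm_bounded_of_sqr (r := r) qM).
  have -> : iota r - 'X_i ^+ 2 =
      (r%:MP - \sum_(i < n) 'X_i ^+ 2) + \sum_(j < n | j != i) 'X_j ^+ 2.
    by rewrite [\sum_(i < n) _](bigD1 i)//= opprD addrA subrK.
  by apply: (MD) => //; apply: qm_sum => // j _; exact: qm_sqr.
- exact: qm_boundedD.
- exact: qm_boundedM.
Qed.

Lemma putinar M f : quadratic_module M -> archimedean iota M ->
  (forall x, (forall p, M p -> 0 <= evalp p x) -> 0 < evalp f x) -> M f.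
Proof.
move=> qM March fpos.
(* If [-1 = m - s f], then [s f - 1 = m] is in [M]. Otherwise a point violating [fpos] is
   constructed. *)
have [[m [s [Mm ss E]]]|N1] := pselect (qm_adjoin M (- f) (-1)).
  apply: (qm_mem_of_sos_mul (iota := iota) (s := s)) => //.
  suff -> : s * f - 1 = m by [].
  by rewrite E; ring.
have [M' [qM' MM' M'N1 M'tot]] := qm_maximal iota (qm_adjoin_qm (- f) qM) N1.
have M'f : M' (- f) by apply: MM'; exact: qm_adjoin_mem.
have {}MM' : M `<=` M' by move=> a Ma; exact/MM'/qm_adjoin_sub.
have M'arch : archimedean iota M'.
  by move=> a; have [r Mr] := March a; exists r; exact: MM'.
have [v vP] := choice (fun i => qm_value_ex (iota := iota) qM' M'N1 M'tot M'arch ('X_i : P)).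
(* The coordinates are the values of the variables; as values respect constants, sums and products,
   the value of any polynomial is its evaluation at [x]. *)
pose x := \row_i v i.
have val p : qm_value iota M' p (evalp p x).
  elim/mpoly_ring_ind : p => [c|i|p q vp vq|p q vp vq].
  - by rewrite evalpC; exact: qm_value_const.
  - by rewrite /evalp mevalXU mxE.
  - by rewrite evalpD; exact: qm_valueD.
  - by rewrite evalpM; exact: qm_valueM.
have ge0 p : M' p -> 0 <= evalp p x.
  by apply: qm_value_ge0 => //; exact: val.
have := ge0 _ M'f; rewrite evalpN oppr_ge0 leNgt fpos// => p Mp.
exact/ge0/MM'.
Qed.

End Putinar.

(** * The quadratic module of [g] and its truncations *)

Section QModule.
Variables (R : realType) (n m : nat) (g : 'I_m -> {mpoly R[n]}).
Implicit Types (f : {mpoly R[n]}) (x : 'rV[R]_n).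

Lemma qmodule_qm : quadratic_module (qmodule g).
Proof.
have [sos1 sosD sosM] := @sos_qm {mpoly R[n]}.
split=> [|_ _ [s [t [ss [ts ->]]]] [s' [t' [ss' [ts' ->]]]]|a _ [s [t [ss [ts ->]]]]].
- exists 1, (fun=> 0); split=> //; split=> [j|].
    exact: (qm_zero (sos_qm _)).
  by rewrite big1 ?addr0// => j _; rewrite mul0r.
- exists (s + s'), (fun j => t j + t' j); split; first exact: sosD.
  split=> [j|/=]; first by apply: sosD; [exact: ts|exact: ts'].
  rewrite addrACA -big_split/=; congr (_ + _); apply: eq_bigr => j _.
  by rewrite mulrDl.
- exists (a ^+ 2 * s), (fun j => a ^+ 2 * t j); split; first exact: sosM.
  split=> [j|/=]; first by apply: sosM; exact: ts.
  rewrite mulrDr mulr_sumr; congr (_ + _); apply: eq_bigr => j _.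
  by rewrite mulrA.
Qed.

Lemma qmodule_gen j : qmodule g (g j).
Proof.
have s0 := qm_zero (@sos_qm {mpoly R[n]}); have [s1 _ _] := @sos_qm {mpoly R[n]}.
exists 0, (fun i => (i == j)%:R); split; first exact: s0.
split=> [i|]; first by case: eqP.
rewrite add0r (bigD1 j)//= eqxx mul1r big1 ?addr0// => i /negbTE ->.
by rewrite mul0r.
Qed.

Lemma is_sos_ge0 (s : {mpoly R[n]}) x : is_sos s -> 0 <= evalp s x.
Proof.
by move=> [l ->]; rewrite evalp_sum; apply: sumr_ge0 => q _; rewrite evalpE sqr_ge0.
Qed.

Lemma qmodule_ge0 f x : qmodule g f -> semialg g x -> 0 <= evalp f x.
Proof.
move=> [s [t [ss [ts ->]]]] Kx; rewrite evalpD evalp_sum addr_ge0//.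
  exact: is_sos_ge0.
by apply: sumr_ge0 => j _; rewrite evalpM; apply: mulr_ge0; [exact: is_sos_ge0|exact: Kx].
Qed.

Lemma qmodule_k_qmodule k f : qmodule_k g k f -> qmodule g f.
Proof. by move=> [s [t [ss [ts [_ [_ E]]]]]]; exists s, t. Qed.

Lemma qmodule_k_le k l f : (k <= l)%N -> qmodule_k g k f -> qmodule_k g l f.
Proof.
move=> kl [s [t [ss [ts [ds [dt E]]]]]]; exists s, t; do ![split=> //].
  by apply: leq_trans ds _; rewrite ltnS leq_mul2l.
by move=> j; apply: leq_trans (dt j) _; rewrite ltnS leq_mul2l.
Qed.

Lemma qmodule_ex_k f : qmodule g f -> exists k, qmodule_k g k f.
Proof.
move=> [s [t [ss [ts ->]]]].
(* Any order dominating the sizes of all the summands will do. *)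
exists (msize s + \max_(j < m) msize (t j * g j)%R)%N; exists s, t.
have le2 a b : (a <= b -> a <= (2 * b).+1)%N.
  by move=> ab; rewrite (leq_trans ab)// mul2n -addnn -addnS leq_addr.
do ![split=> //].
  by apply: le2; exact: leq_addr.
move=> j; apply: le2; apply: leq_trans (leq_addl _ _).
exact: (leq_bigmax_cond (F := fun j => msize (t j * g j)%R)).
Qed.

Lemma putinar_qmodule f : archimedean_qm g ->
  (forall x, semialg g x -> 0 < evalp f x) -> exists k, qmodule_k g k f.
Proof.
move=> [r [_ gr]] fpos; apply: qmodule_ex_k; apply: putinar.
- exact: qmodule_qm.
- by apply: qm_archimedean; [exact: qmodule_qm|exists r].
- by move=> x xge0; apply: fpos => j; apply: xge0; exact: qmodule_gen.
Qed.

End QModule.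

(** * Convergence of the hierarchy *)

Section Approximation.
Variables (R : realType) (n : nat) (K : set 'rV[R]_n).
Hypothesis Kcompact : compact K.
Implicit Types (f p q : {mpoly R[n]}) (x : 'rV[R]_n).

Lemma evalp_continuous f : continuous (evalp f).
Proof.
elim/mpoly_ring_ind : f => [c|i|f p cf cp|f p cf cp] x.
- have -> : evalp (c%:MP : {mpoly R[n]}) = cst c by apply/funext => y; exact: evalpC.
  exact: cst_continuous.
- have -> : evalp ('X_i : {mpoly R[n]}) = (fun y : 'rV[R]_n => y ord0 i).
    by apply/funext => y; exact: mevalXU.
  exact: coord_continuous.
- have -> : evalp (f + p) = evalp f \+ evalp p by apply/funext => y; exact: evalpD.
  exact: (continuousD (cf x) (cp x)).
- have -> : evalp (f * p) = evalp f \* evalp p by apply/funext => y; exact: evalpM.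
  exact: (continuousM (cf x) (cp x)).
Qed.

Lemma evalp_le_compact f : exists b, forall x, K x -> evalp f x <= b.
Proof.
have [->|/set0P K0] := eqVneq K set0; first by exists 0.
have [c _ cmax] := compact_EVT_max K0 Kcompact
  (continuous_subspaceT (@evalp_continuous f)).
by exists (evalp f c) => x Kx; apply: cmax; rewrite inE.
Qed.

Lemma evalp_norm_le_compact f : exists2 b, 0 < b & forall x, K x -> `|evalp f x| <= b.
Proof.
have [b1 fb1] := evalp_le_compact f; have [b2 fb2] := evalp_le_compact (- f).
exists (`|b1| + `|b2| + 1); first by rewrite ltr_wpDl.
move=> x Kx; have {}fb1 := fb1 _ Kx; have := fb2 _ Kx; rewrite evalpN => {}fb2.
have n1 := ler_norm b1; have n2 := ler_norm b2.
have p1 := normr_ge0 b1; have p2 := normr_ge0 b2.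
by rewrite ler_norml; apply/andP; split; lra.
Qed.

Lemma evalp_gt0_compact f : (forall x, K x -> 0 < evalp f x) ->
  exists2 a, 0 < a & forall x, K x -> a <= evalp f x.
Proof.
move=> f0; have [->|/set0P K0] := eqVneq K set0; first by exists 1.
have [c Kc cmin] := compact_EVT_min K0 Kcompact
  (continuous_subspaceT (@evalp_continuous f)).
exists (evalp f c); first by apply: f0; move: Kc; rewrite inE.
by move=> x Kx; apply: cmin; rewrite inE.
Qed.

(* On K one has 0 < a <= q <= b, so 1 - q/b lies in [0, 1 - a/b] and 1/q is the
   uniform limit of the polynomials b^-1 * \sum_(j < N) (1 - q/b)^j. *)
Lemma rational_lower_approx p q d :
  (forall x, K x -> 0 < evalp q x) -> 0 < d ->
  exists h, forall x, K x -> evalp p x / evalp q x - d < evalp h x /\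
    evalp h x < evalp p x / evalp q x.
Proof.
move=> q0 d0.
have [a a0 qa] := evalp_gt0_compact q0.
have [b0 b00 qb0] := evalp_norm_le_compact q.
have [c c0 pc] := evalp_norm_le_compact p.
(* This [b] bounds [q] on [K] and also exceeds [a], so that [z] is nonnegative even when [K] is
   empty. *)
pose b := a + b0; have b_gt0 : 0 < b by rewrite addr_gt0.
pose z := 1 - a / b.
have z0 : 0 <= z by rewrite subr_ge0 ler_pdivrMr// mul1r lerDl ltW.
have z1 : z < 1 by rewrite ltrBlDr ltrDl divr_gt0.
(* Since [c / a] bounds [|p / q|] on [K], this controls the remainder [(p / q) u^N] of the geometric
   series. *)
have [N zN] : exists N, c / a * z ^+ N < d / 2.
  have e0 : 0 < d / 2 / (c / a) by rewrite !divr_gt0.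
  have nz1 : `|z| < 1 by rewrite ger0_norm.
  have /cvgrPdist_lt /(_ _ e0) [N _ /(_ N)] := cvg_expr nz1.
  rewrite /= leqnn sub0r normrN ger0_norm ?exprn_ge0// => /(_ isT) zN.
  by exists N; rewrite mulrC -ltr_pdivlMr// divr_gt0.
pose u : {mpoly R[n]} := 1 - b^-1%:MP * q.
(* The partial sum is within [d / 2] of [p / q]; the downward shift by [d / 2] puts it strictly
   between [p / q - d] and [p / q]. *)
exists (b^-1%:MP * p * (\sum_(j < N) u ^+ j) - (d / 2)%:MP) => x Kx.
rewrite evalpB !evalpM !evalpC.
have qx0 := q0 _ Kx; have qax := qa _ Kx.
have ux : evalp u x = 1 - b^-1 * evalp q x.
  by rewrite evalpB evalp1 evalpM evalpC.
clearbody u.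
have E : b^-1 * evalp p x * evalp (\sum_(j < N) u ^+ j) x =
    evalp p x / evalp q x - evalp p x / evalp q x * evalp u x ^+ N.
  have := congr1 (fun f => evalp f x) (subrX1 u N).
  rewrite /= evalpM !evalpB evalpE evalp1 ux => S.
  have -> : (1 - b^-1 * evalp q x) ^+ N =
      1 - b^-1 * evalp q x * evalp (\sum_(j < N) u ^+ j) x.
    by apply/eqP; rewrite -(inj_eq (addIr (- 1))) S; apply/eqP; ring.
  by field; rewrite gt_eqF//= gt_eqF.
have u0 : 0 <= evalp u x.
  rewrite ux subr_ge0 mulrC ler_pdivrMr// mul1r.
  by have := qb0 _ Kx; have := ler_norm (evalp q x); rewrite /b; lra.
have uz : evalp u x <= z.
  by rewrite ux /z lerB// mulrC ler_wpM2l// invr_ge0 ltW.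
have : `|evalp p x / evalp q x * evalp u x ^+ N| < d / 2.
  apply: le_lt_trans zN; rewrite !normrM normfV normrX (ger0_norm u0) (gtr0_norm qx0).
  apply: ler_pM => //; first by rewrite divr_ge0// ltW.
  - by rewrite exprn_ge0.
  - apply: ler_pM => //; first by rewrite invr_ge0 ltW.
      exact: pc.
    by rewrite lef_pV2// posrE.
  - by rewrite lerXn2r// nnegrE.
rewrite E ltr_norml => /andP[e1 e2]; split; lra.
Qed.

End Approximation.

(** * Monotonicity, upper bound and convergence of [rho_k] *)

Section Hierarchy.
Variables (R : realType) (n m N : nat).
Variables (p q : 'I_N.+1 -> {mpoly R[n]}) (g : 'I_m -> {mpoly R[n]}).
Hypothesis qpos : forall i x, semialg g x -> 0 < evalp (q i) x.

Lemma rho_k_le k l : (k <= l)%N -> (rho_k g p q k <= rho_k g p q l)%E.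
Proof.
move=> kl; apply: ereal_sup_le => _ [c [h [dh [h0 hi]]] <-].
exists c => //; exists h; split=> [i i0|].
  by apply: leq_trans (dh i i0) _; rewrite ltnS leq_sub2r// leq_mul2l.
by split=> [|i i0]; [exact: qmodule_k_le h0|exact: qmodule_k_le (hi i i0)].
Qed.

(** On [K], dividing the certificates by [q_i > 0] gives [h_i <= p_i / q_i] and
    [c - sum h_i <= p_1 / q_1]; in the sum the [h_i] cancel. *)
Lemma rho_k_le_rho_opt k : (rho_k g p q k <= rho_opt g p q)%E.
Proof.
apply: ge_ereal_sup => _ [c [h [_ [h0 hi]]] <-].
apply: le_ereal_inf_tmp => _ [x Kx <-]; rewrite lee_fin.
have := qmodule_ge0 (qmodule_k_qmodule h0) Kx.
rewrite evalpD evalpM evalpB evalp_sum evalpC => H0.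
have Hi i : i != ord0 -> evalp (h i) x <= evalp (p i) x / evalp (q i) x.
  move=> i0; rewrite ler_pdivlMr ?qpos//.
  have := qmodule_ge0 (qmodule_k_qmodule (hi i i0)) Kx.
  by rewrite evalpB evalpM subr_ge0.
rewrite (bigD1 ord0)//= -lerBlDr.
apply: (@le_trans _ _ (c - \sum_(i < N.+1 | i != ord0) evalp (h i) x)).
  by rewrite lerB// ler_sum.
by rewrite ler_pdivlMr ?qpos//; lra.
Qed.

(** A real [c'] is needed to measure the slack above [c], whereas [rho_opt] is [+oo] when [K] is
    empty. *)
Lemma rho_opt_gt c : (c%:E < rho_opt g p q)%E ->
  exists2 c', c < c' & forall x, semialg g x ->
    c' <= \sum_(i < N.+1) evalp (p i) x / evalp (q i) x.
Proof.
move=> crho.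
have [c' [cc' c'rho]] : exists c', c < c' /\ (c'%:E <= rho_opt g p q)%E.
  case: (rho_opt g p q) crho => [r|_|//]; last by exists (c + 1); rewrite leey ltrDl.
  by rewrite lte_fin => cr; exists r.
exists c' => // x Kx; rewrite -lee_fin; apply: le_trans c'rho _.
by apply: ereal_inf_lbound; exists x.
Qed.

Lemma rho_k_ge c : compact (semialg g) -> archimedean_qm g ->
  (c%:E < rho_opt g p q)%E -> exists k, (c%:E <= rho_k g p q k)%E.
Proof.
move=> Kcompact garch /rho_opt_gt[c' cc' c'le].
(* The [N] approximations with nonzero index lose at most [N d] in total, which leaves a margin of
   [d] for strict positivity of the first certificate. *)
pose d := (c' - c) / N.+1%:R.
have d0 : 0 < d by rewrite divr_gt0// subr_gt0.
have [h hP] := choice (fun i => rational_lower_approx Kcompact (p i) (qpos i) d0).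
have kex i : exists k, qmodule_k g k (p i - h i * q i).
  apply: putinar_qmodule => // x Kx.
  rewrite evalpB evalpM subr_gt0 -ltr_pdivlMr ?qpos//.
  by have [] := hP i x Kx.
have [l lP] := choice kex.
have [k0 k0P] : exists k0, qmodule_k g k0
    (p ord0 + (\sum_(i < N.+1 | i != ord0) h i - c%:MP) * q ord0).
  apply: putinar_qmodule => // x Kx; have q0 := qpos ord0 Kx.
  rewrite evalpD evalpM evalpB evalp_sum evalpC.
  rewrite -[evalp (p ord0) x](divfK (lt0r_neq0 q0)) -mulrDl mulr_gt0//.
  have := c'le x Kx; rewrite (bigD1 ord0)//= => c'le0.
  have hge : \sum_(i < N.+1 | i != ord0) (evalp (p i) x / evalp (q i) x - d) <=
      \sum_(i < N.+1 | i != ord0) evalp (h i) x.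
    by apply: ler_sum => i _; rewrite ltW//; have [] := hP i x Kx.
  have : \sum_(i < N.+1) d = c' - c.
    by rewrite sumr_const card_ord -mulr_natr divfK// pnatr_eq0.
  rewrite (bigD1 ord0)//= => dE.
  by move: hge; rewrite big_split/= sumrN; lra.
(* [l i] serves membership of [p i - h i * q i], the rest the degree bound on [h i], including that
   the truncated subtraction there does not cut off at 0. *)
pose w i := (l i + (msize (h i) + maxn (deg (q ord0)) (deg (q i))))%N.
have wk i : (w i <= k0 + \max_i w i)%N.
  by apply: leq_trans (leq_addl _ _); exact: leq_bigmax.
exists (k0 + \max_i w i)%N; apply: ereal_sup_ubound; exists c => //.
exists h; split=> [i _|].
  have /(leq_trans (leq_addl _ _)) := wk i.
  rewrite /deg_le => le; apply: leqW; rewrite leq_subRL.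
    by rewrite addnC; apply: leq_trans le _; rewrite mul2n -addnn leq_addr.
  apply: leq_trans (leq_addl _ _) (leq_trans le _).
  by rewrite mul2n -addnn leq_addr.
split=> [|i _]; first by apply: qmodule_k_le k0P; exact: leq_addr.
by apply: qmodule_k_le (lP i); apply: leq_trans (leq_addr _ _) (wk i).
Qed.

End Hierarchy.

Theorem theorem3p3 (R : realType) (n m N : nat) (hn : (0 < n)%N) (hm : (0 < m)%N)
  (p q : 'I_N.+1 -> {mpoly R[n]}) (g : 'I_m -> {mpoly R[n]})
  (hK : compact (semialg g))
  (hq : forall i x, semialg g x -> 0 < evalp (q i) x)
  (harch : archimedean_qm g) :
  (forall k : nat, (d_min g p q <= k)%N ->
     (rho_k g p q k <= rho_k g p q k.+1)%E /\ (rho_k g p q k.+1 <= rho_opt g p q)%E) /\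
  (fun k => rho_k g p q k) @ \oo --> rho_opt g p q.
Proof.
split=> [k _|]; first by split; [exact: rho_k_le|exact: rho_k_le_rho_opt].
(* A nondecreasing sequence of extended reals tends to its supremum, so it remains to identify the
   latter with [rho_opt]. *)
have -> : rho_opt g p q = ereal_sup (range (rho_k g p q)).
  apply/le_anti/andP; split; last first.
    by apply: ge_ereal_sup => _ [k _ <-]; exact: rho_k_le_rho_opt.
  rewrite leNgt; apply/negP => srho.
  have [c sc crho] : exists2 c, (ereal_sup (range (rho_k g p q)) < c%:E)%E &
      (c%:E < rho_opt g p q)%E.
    (* Either side may be infinite, so a real number strictly in between is chosen case by case. *)
    case: (ereal_sup _) (rho_opt g p q) srho => [s||] [r||]//.
    - rewrite lte_fin => sr; exists ((s + r) / 2); rewrite lte_fin; lra.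
    - by move=> _; exists (s + 1); rewrite ?lte_fin ?ltrDl// ltry.
    - by move=> _; exists (r - 1); rewrite ?ltNyr// lte_fin ltrBlDr ltrDl.
    - by move=> _; exists 0; rewrite ?ltNyr ?ltry.
  have [k ck] := rho_k_ge hq hK harch crho.
  have := lt_le_trans sc ck; rewrite ltNge => /negP; apply.
  by apply: ereal_sup_ubound; exists k.
by apply: ereal_nondecreasing_cvgn => k l; exact: rho_k_le.
Qed.
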